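(* Let $\mathbb{P}$ be a logic program, $[\![\cdot]\!]_{p^\sharp}:At\to\mathcal{C}(\mathcal{S})(At)$ its saturated semantics and $\overline{d}:\mathcal{U}\big(\mathcal{C}(\mathcal{S})(At)\big)\to\mathcal{C}(\widehat{\mathcal{P}_c}\widehat{\mathcal{P}_f})(\mathcal{U}At)$ the desaturation map. Then for all $n\in|\mathbf{L}|$ and $A\in\mathcal{U}At(n)$, the $n$-coinductive tree of $A$ in $\mathbb{P}$ is $\big(\overline{d}\circ\mathcal{U}([\![\cdot]\!]_{p^\sharp})\big)(n)(A)$.
   Context: Fix a signature $\Sigma$ (at most countable) and predicate symbols with arities. $\mathbf{L}$ denotes $\mathbf{L}_\Sigma^{op}$, the (opposite) Lawvere theory of $\Sigma$: objects are natural numbers; an arrow (substitution) $n\to m$ is an $n$-tuple of $\Sigma$-terms with variables among $x_1,\dots,x_m$; $id_n=\langle x_1,\dots,x_n\rangle$; composition is substitution of terms for variables. $|\mathbf{L}|$ is the discrete category on the objects of $\mathbf{L}$. The presheaf $At:\mathbf{L}\to\mathbf{Set}$ maps $n$ to the set of atoms with variables among $x_1,\dots,x_n$, and $At(\theta)(A)=A\theta$. A logic program $\mathbb{P}$ is a finite set of clauses $H\leftarrow B_1,\dots,B_k$ ($k\ge0$). $\mathcal{P}_c,\mathcal{P}_f$ are the countable and finite powerset functors; $\widehat{\mathcal{P}_c},\widehat{\mathcal{P}_f}$ their extensions to $\mathbf{Set}^{|\mathbf{L}|}$ by postcomposition; write $\mathcal{Q}=\widehat{\mathcal{P}_c}\widehat{\mathcal{P}_f}$.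 $\mathcal{U}:\mathbf{Set}^{\mathbf{L}}\to\mathbf{Set}^{|\mathbf{L}|}$ is the forgetful functor, with right adjoint $\mathcal{K}(F)(n)=\prod_{\theta:n\to m}F(m)$ (product over all arrows of $\mathbf{L}$ with source $n$), $\mathcal{K}(F)(\theta)(\dot x)=\langle\dot x(\sigma\circ\theta)\rangle_\sigma$. The unit is $\eta_G(n)(x)=\langle G(\theta)(x)\rangle_\theta$ and the counit $\epsilon_F:\mathcal{U}\mathcal{K}F\to F$ is $\epsilon_F(n)(\dot x)=\dot x(id_n)$. Put $\mathcal{S}=\mathcal{K}\mathcal{Q}\mathcal{U}$. Program coalgebras: $p(n)(A)=\{\{B_1\tau,\dots,B_k\tau\}\mid(H\leftarrow B_1,\dots,B_k)\in\mathbb{P},\ A=H\tau,\ B_i\tau\in At(n)\}$ defines $p:\mathcal{U}At\to\mathcal{Q}\,\mathcal{U}At$, and $p^\sharp=\mathcal{K}(p)\circ\eta_{At}:At\to\mathcal{S}(At)$, i.e. $p^\sharp(n)(A)=\langle p(m)(A\sigma)\rangle_{\sigma:n\to m}$. Terminal sequences: in $\mathbf{Set}^{\mathbf{L}}$, $X_0=At$, $X_{\beta+1}=At\times\mathcal{S}(X_\beta)$, $\delta_0=\pi_1:X_1\to X_0$, $\delta_{\beta+1}=id_{At}\times\mathcal{S}(\delta_\beta)$, with limits at limit ordinals; it converges at some $\gamma$ ($X_{\gamma+1}\cong X_\gamma$ via $\delta_\gamma$), and $\mathcal{C}(\mathcal{S})(At):=X_\gamma$ is the carrier of the final $At\times\mathcal{S}(\cdot)$-coalgebra.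 $[\![\cdot]\!]_{p^\sharp}:At\to X_\gamma$ is the unique coalgebra morphism from $(At,\langle id,p^\sharp\rangle)$ to it. In $\mathbf{Set}^{|\mathbf{L}|}$, $Y_0=\mathcal{U}At$, $Y_{\beta+1}=\mathcal{U}At\times\mathcal{Q}(Y_\beta)$, $\xi_0=\pi_1$, $\xi_{\beta+1}=id\times\mathcal{Q}(\xi_\beta)$, with limits at limit ordinals; it converges at some $\chi$, and $\mathcal{C}(\mathcal{Q})(\mathcal{U}At):=Y_\chi$ is the carrier of the final $\mathcal{U}At\times\mathcal{Q}(\cdot)$-coalgebra. Desaturation: define $d_\alpha:\mathcal{U}(X_\alpha)\to Y_\alpha$ by $d_0=id_{\mathcal{U}At}$, $d_{\beta+1}=id_{\mathcal{U}At}\times\big(\mathcal{Q}(d_\beta)\circ\epsilon_{\mathcal{Q}\mathcal{U}(X_\beta)}\big)$ (using that $\mathcal{U}$ preserves products, $\mathcal{U}(X_{\beta+1})\cong\mathcal{U}At\times\mathcal{U}\mathcal{K}\mathcal{Q}\mathcal{U}(X_\beta)$), and, for $\alpha$ a limit ordinal, by the limiting property of $Y_\alpha$ (the maps satisfy $\xi_\beta\circ d_{\beta+1}=d_\beta\circ\mathcal{U}(\delta_\beta)$). Then $\overline d:\mathcal{U}(X_\gamma)\to Y_\chi$ is: if $\chi\le\gamma$, the composite of the sequence map $\mathcal{U}(X_\gamma)\to\mathcal{U}(X_\chi)$ with $d_\chi$; if $\gamma<\chi$, the composite of the isomorphism $\mathcal{U}(X_\gamma)\cong\mathcal{U}(X_\chi)$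 with $d_\chi$ (extending the sequence). Trees: an element $T\in Y_\chi(n)$, whose image under the final coalgebra structure is $(A,Z)$ with $A\in At(n)$, $Z\in\mathcal{P}_c\mathcal{P}_f(Y_\chi(n))$, is identified with the tree whose root is an $\wedge$-node labeled $A$, having one $\vee$-child (labeled $\bullet$) for each $S\in Z$, whose children are the roots of the trees given by the elements of $S$. The $n$-coinductive tree for $A\in At(n)$ in $\mathbb{P}$ is the possibly infinite tree with alternating $\wedge$-nodes, labeled with atoms of $At(n)$, and $\vee$-nodes, labeled $\bullet$, whose root is an $\wedge$-node labeled $A$, such that for every $\wedge$-node $s$ with label $A'\in At(n)$: for every clause $H\leftarrow B_1,\dots,B_k$ of $\mathbb{P}$ and every $\tau$ with $A'=H\tau$ and $B_1\tau,\dots,B_k\tau\in At(n)$, $s$ has exactly one child $t$, and $s$ has no other children; and for each atom $B$ in the set $\{B_1,\dots,B_k\}\tau$, $t$ has exactly one child labeled $B$, and no other children. (Children of a node form a set: choices of clause and $\tau$ yielding the same set $\{B_1,\dots,B_k\}\tau$ give the same child.) *)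

(* Defs.v *)
From Stdlib Require Import Relation_Operators.
From mathcomp Require Import all_boot all_order.
From mathcomp Require Import boolp classical_sets functions cardinality.

Set Implicit Arguments.
Unset Strict Implicit.
Unset Printing Implicit Defensive.

Import Order.TTheory.

Local Open Scope classical_set_scope.

#[local] Obligation Tactic := idtac.

Record category := Category {
  ob :> Type;
  hom : ob -> ob -> Type;
  idm : forall a, hom a a;
  mcomp : forall a b c, hom b c -> hom a b -> hom a c;
  mcomp1l : forall a b (f : hom a b), mcomp (idm b) f = f;
  mcomp1r : forall a b (f : hom a b), mcomp f (idm a) = f;
  mcompA : forall a b c d (h : hom c d) (g : hom b c) (f : hom a b),
    mcomp h (mcomp g f) = mcomp (mcomp h g) f }.

Arguments hom {_} _ _.
Arguments idm {_} _.
Arguments mcomp {_ _ _ _} _ _.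

Declare Scope cat_scope.
Delimit Scope cat_scope with cat.
Local Open Scope cat_scope.
Notation "g ∘ f" := (mcomp g f) (at level 40, left associativity) : cat_scope.

Definition inverse_of (C : category) (a b : C) (f : hom a b) (g : hom b a) :=
  g ∘ f = idm a /\ f ∘ g = idm b.

Definition is_iso (C : category) (a b : C) (f : hom a b) :=
  exists g : hom b a, inverse_of f g.

Definition inverse (C : category) (a b : C) (f : hom a b) (f_iso : is_iso f) :
  hom b a := sval (cid f_iso).

Record isomorphism (C : category) (a b : C) := Isomorphism {
  iso_hom : hom a b;
  iso_inv : hom b a;
  iso_spec : inverse_of iso_hom iso_inv }.

Record functor (C D : category) := Functor {
  fob :> C -> D;
  fmap : forall a b, hom a b -> hom (fob a) (fob b);
  fmap1 : forall a, fmap (idm a) = idm (fob a);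
  fmapM : forall a b c (g : hom b c) (f : hom a b),
    fmap (g ∘ f) = fmap g ∘ fmap f }.

Arguments fmap {_ _} _ {_ _} _.

Definition TYPE : category.
Proof.
by apply: (@Category Type (fun A B => A -> B) (fun A x => x)
  (fun A B C g f x => g (f x))).
Defined.

Program Definition functor_comp (C D E : category)
    (G : functor D E) (F : functor C D) : functor C E :=
  @Functor C E (fun a => G (F a)) (fun a b f => fmap G (fmap F f)) _ _.
Next Obligation. by move=> C D E G F a /=; rewrite !fmap1. Qed.
Next Obligation. by move=> C D E G F a b c g f /=; rewrite !fmapM. Qed.

Record nat_trans (C D : category) (F G : functor C D) := NatTrans {
  nt :> forall a, hom (F a) (G a);
  nt_natural : forall a b (f : hom a b), nt b ∘ fmap F f = fmap G f ∘ nt a }.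

Lemma nat_trans_eq (C D : category) (F G : functor C D) (s t : nat_trans F G) :
  (forall a, s a = t a) -> s = t.
Proof.
case: s t => [s sN] [t tN] /= st; have {}st : s = t by exact: functional_extensionality_dep.
by subst t; congr NatTrans; exact: Prop_irrelevance.
Qed.

Program Definition functor_category (C D : category) : category :=
  @Category (functor C D) (@nat_trans C D)
    (fun F => @NatTrans C D F F (fun a => idm (F a)) _)
    (fun F G H t s => @NatTrans C D F H (fun a => t a ∘ s a) _) _ _ _.
Next Obligation. by move=> C D F a b f; rewrite mcomp1l mcomp1r. Qed.
Next Obligation.
by move=> C D F G H t s a b f; rewrite -mcompA nt_natural !mcompA nt_natural.
Qed.
Next Obligation. by move=> *; apply: nat_trans_eq => a /=; rewrite mcomp1l. Qed.
Next Obligation. by move=> *; apply: nat_trans_eq => a /=; rewrite mcomp1r. Qed.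
Next Obligation. by move=> *; apply: nat_trans_eq => a /=; rewrite mcompA. Qed.

(* [Fam I] is the category of functors from the discrete category on [I] to   *)
(* [TYPE], i.e. of I-indexed families.                                        *)
Definition Fam (I : Type) : category.
Proof.
by apply: (@Category (I -> Type) (fun F G => forall i, F i -> G i)
  (fun F i x => x) (fun F G H t s i x => t i (s i x))).
Defined.

Definition PSh (C : category) : category := functor_category C TYPE.

Program Definition psh_prod (C : category) (A : PSh C) :
    functor (PSh C) (PSh C) :=
  @Functor (PSh C) (PSh C)
    (fun F => @Functor C TYPE (fun c => (A c * F c)%type)
       (fun c d f x => (fmap A f x.1, fmap F f x.2)) _ _)
    (fun F G t => @NatTrans C TYPE _ _ (fun c x => (x.1, t c x.2)) _) _ _.
Next Obligation.
by move=> C A F c; apply: funext => -[x y] /=; rewrite !fmap1.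
Qed.
Next Obligation.
by move=> C A F c d e g f; apply: funext => -[x y] /=; rewrite !fmapM.
Qed.
Next Obligation.
move=> C A F G t c d f; apply: funext => -[x y] /=.
by have /(congr1 (@^~ y)) /= -> := nt_natural t f.
Qed.
Next Obligation.
by move=> C A F; apply: nat_trans_eq => c; apply: funext => -[x y].
Qed.
Next Obligation.
by move=> *; apply: nat_trans_eq => c; apply: funext => -[x y].
Qed.

Program Definition psh_fst (C : category) (A F : PSh C) : hom (psh_prod A F) A :=
  @NatTrans C TYPE (psh_prod A F) A (fun c x => x.1) _.
Next Obligation. by []. Qed.

Program Definition psh_pair (C : category) (Z A F : PSh C)
    (f : hom Z A) (g : hom Z F) : hom Z (psh_prod A F) :=
  @NatTrans C TYPE Z (psh_prod A F) (fun c x => (nt f c x, nt g c x)) _.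
Next Obligation.
move=> C Z A F f g c d u; apply: funext => x /=.
have /(congr1 (@^~ x)) /= -> := nt_natural f u.
by have /(congr1 (@^~ x)) /= -> := nt_natural g u.
Qed.

Program Definition fam_prod (I : Type) (A : Fam I) : functor (Fam I) (Fam I) :=
  @Functor (Fam I) (Fam I) (fun F i => (A i * F i)%type)
    (fun F G t i x => (x.1, t i x.2)) _ _.
Next Obligation.
move=> I A F; apply: functional_extensionality_dep => i.
by apply: funext => -[x y].
Qed.
Next Obligation. by []. Qed.

Definition fam_fst (I : Type) (A F : Fam I) : hom (fam_prod A F) A :=
  fun i x => x.1.
Arguments fam_fst {_} _ _ _ _.

Local Open Scope order_scope.

(* A well-ordered type with a least element and without a greatest one, i.e.  *)
(* the set of all ordinals below some limit ordinal.  Any given ordinals live *)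
(* in such a type.                                                            *)
Record ordinals := Ordinals {
  ord_disp : Order.disp_t;
  ord_type :> orderType ord_disp;
  ord_wf : well_founded (fun a b : ord_type => a < b);
  ord_zero : ord_type;
  ord_zero_le : forall a, ord_zero <= a;
  ord_succ : ord_type -> ord_type;
  ord_succ_le : forall a b, (ord_succ a <= b) = (a < b) }.

Arguments ord_zero {_}.
Arguments ord_succ {_} _.

Definition is_limit (O : ordinals) (l : O) :=
  l != ord_zero /\ forall a, a < l -> ord_succ a < l.

Record chain (C : category) (O : ordinals) := Chain {
  chain_ob :> O -> C;
  res : forall a b : O, b <= a -> hom (chain_ob a) (chain_ob b);
  res_id : forall a (h : a <= a), res h = idm (chain_ob a);
  res_comp : forall a b c (h1 : b <= a) (h2 : c <= b) (h3 : c <= a),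
    res h2 ∘ res h1 = res h3 }.

Arguments res {_ _} _ {_ _} _.

Definition limit_cone (C : category) (O : ordinals) (X : chain C O) (l : O) :=
  forall (Z : C) (f : forall b, b < l -> hom Z (X b)),
    (forall b c (hb : b < l) (hc : c < l) (h : c <= b), res X h ∘ f b hb = f c hc) ->
    exists! u : hom Z (X l), forall b (hb : b < l), res X (ltW hb) ∘ u = f b hb.

Lemma le_succ (O : ordinals) (a : O) : a <= ord_succ a.
Proof. by rewrite ltW// -ord_succ_le. Qed.

Lemma succ_mono (O : ordinals) (a b : O) : b <= a -> ord_succ b <= ord_succ a.
Proof. by move=> ba; rewrite ord_succ_le (le_lt_trans ba)// -ord_succ_le. Qed.

(* The sequence  B <- H B <- H (H B) <- ...  obtained by iterating [H]        *)
(* transfinitely from [b0 : H B -> B].  Objects are only determined up to     *)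
(* isomorphism, as limits are.                                                *)
Record terminal_sequence (C : category) (H : functor C C) (B : C)
    (b0 : hom (H B) B) (O : ordinals) := TerminalSequence {
  ts_chain :> chain C O;
  ts_zero : isomorphism (ts_chain ord_zero) B;
  ts_succ : forall a, isomorphism (ts_chain (ord_succ a)) (H (ts_chain a));
  ts_res_zero :
    iso_hom ts_zero ∘ res ts_chain (le_succ ord_zero) =
    b0 ∘ fmap H (iso_hom ts_zero) ∘ iso_hom (ts_succ ord_zero);
  ts_res_succ : forall a b (h : b <= a),
    iso_hom (ts_succ b) ∘ res ts_chain (succ_mono h) =
    fmap H (res ts_chain h) ∘ iso_hom (ts_succ a);
  ts_limit : forall l, is_limit l -> limit_cone ts_chain l }.

Section SequenceTheory.
Context (C : category) (O : ordinals).
Implicit Types (a b c l : O).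

Lemma ord_ind (P : O -> Prop) :
  (forall a, (forall b, b < a -> P b) -> P a) -> forall a, P a.
Proof. by move=> IH; apply: (well_founded_ind (@ord_wf O)). Qed.

Lemma lt_succ a : a < ord_succ a.
Proof. by rewrite -ord_succ_le. Qed.

Lemma succ_inj : injective (@ord_succ O).
Proof.
move=> a b ab; apply: le_anti; rewrite !leNgt; apply/andP; split; apply/negP.
  by rewrite -ord_succ_le => /le_lt_trans/(_ (lt_succ a)); rewrite ab ltxx.
by rewrite -ord_succ_le => /le_lt_trans/(_ (lt_succ b)); rewrite ab ltxx.
Qed.

Lemma succ_lt a b : (b < ord_succ a) = (b <= a).
Proof. by rewrite !ltNge ord_succ_le -leNgt. Qed.

Lemma succ_neq0 a : ord_succ a != ord_zero.
Proof.
apply/eqP => a0; have := lt_succ a.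
by rewrite a0 ltNge ord_zero_le.
Qed.

Lemma ord_cases a :
  [\/ a = ord_zero, exists b, a = ord_succ b | is_limit a].
Proof.
have [->|a0] := eqVneq a ord_zero; first by constructor 1.
have [[b ab]|nb] := pselect (exists b, a = ord_succ b).
  by constructor 2; exists b.
constructor 3; split => // b ba; rewrite lt_neqAle ord_succ_le ba andbT.
by apply/eqP => e; apply: nb; exists b.
Qed.

Lemma not_limit_succ a : ~ is_limit (ord_succ a).
Proof. by case=> _ /(_ a (lt_succ a)); rewrite ltxx. Qed.

Lemma not_limit0 : ~ is_limit (@ord_zero O).
Proof. by case; rewrite eqxx. Qed.

Lemma res_irr (X : chain C O) a b (h h' : b <= a) : res X h = res X h'.
Proof. by congr (res X _); exact: bool_irrelevance. Qed.

Lemma limit_monic (X : chain C O) l : limit_cone X l ->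
  forall (Z : C) (u v : hom Z (X l)),
    (forall b (hb : b < l), res X (ltW hb) ∘ u = res X (ltW hb) ∘ v) -> u = v.
Proof.
move=> Xl Z u v uv.
have [|w [_ wP]] := Xl Z (fun b hb => res X (ltW hb) ∘ v).
  by move=> b c hb hc h; rewrite mcompA (res_comp _ _ _ (ltW hc)).
by rewrite -(wP u)// -(wP v).
Qed.

Lemma inverseP (a b : C) (f : hom a b) (fi : is_iso f) : inverse_of f (inverse fi).
Proof. exact: svalP. Qed.

Lemma iso_invK (a b : C) (i : isomorphism a b) : iso_inv i ∘ iso_hom i = idm a.
Proof. by case: (iso_spec i). Qed.

Lemma iso_homK (a b : C) (i : isomorphism a b) : iso_hom i ∘ iso_inv i = idm b.
Proof. by case: (iso_spec i). Qed.

Lemma iso_move (a b c : C) (i : isomorphism a b) (f : hom c a) (g : hom c b) :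
  iso_hom i ∘ f = g <-> f = iso_inv i ∘ g.
Proof.
split=> [<-|->]; first by rewrite mcompA iso_invK mcomp1l.
by rewrite mcompA iso_homK mcomp1l.
Qed.

Section Recursion.
Context (Z Y : chain C O).
Context (e0 : hom (Z ord_zero) (Y ord_zero)).
Context (s : forall a, hom (Z a) (Y a) -> hom (Z (ord_succ a)) (Y (ord_succ a))).

Definition compat a b (h : b <= a) (f : hom (Z a) (Y a)) (g : hom (Z b) (Y b)) :=
  res Y h ∘ f = g ∘ res Z h.

Hypothesis Y_limit : forall l, is_limit l -> limit_cone Y l.
Hypothesis s0 : compat (le_succ ord_zero) (s e0) e0.
Hypothesis s_compat : forall a b (h : b <= a) f g,
  compat h f g -> compat (succ_mono h) (s f) (s g).

Definition recursive (e : forall a, hom (Z a) (Y a)) :=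
  [/\ e ord_zero = e0,
      forall a, e (ord_succ a) = s (e a) &
      forall l, is_limit l -> forall b (h : b < l), compat (ltW h) (e l) (e b)].

Definition graph_body a (rec : forall b, b < a -> hom (Z b) (Y b) -> Prop)
    (f : hom (Z a) (Y a)) : Prop :=
  [/\ forall E : ord_zero = a, f = eq_rect ord_zero (fun a => hom (Z a) (Y a)) e0 a E,
      forall b (E : ord_succ b = a), exists2 g, (forall h : b < a, rec b h g) &
        f = eq_rect (ord_succ b) (fun a => hom (Z a) (Y a)) (s g) a E &
      is_limit a -> forall b (h : b < a), exists2 g, rec b h g & compat (ltW h) f g].

Definition graph : forall a, hom (Z a) (Y a) -> Prop :=
  Fix (@ord_wf O) (fun a => hom (Z a) (Y a) -> Prop) graph_body.

Lemma graphE a f : @graph a f = graph_body (fun b _ => @graph b) f.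
Proof.
rewrite {1}/graph Fix_eq// => {f}b r r' rr'.
have -> // : r = r'.
by apply: functional_extensionality_dep => c; apply: functional_extensionality_dep.
Qed.

Lemma graph0 f : @graph ord_zero f <-> f = e0.
Proof.
rewrite graphE; split=> [[/(_ erefl)]//|->]; split.
- by move=> E; rewrite (eq_axiomK E).
- by move=> b E; case/eqP: (succ_neq0 b).
- by move/not_limit0.
Qed.

Lemma graphS a f : @graph (ord_succ a) f <-> exists2 g, @graph a g & f = s g.
Proof.
rewrite graphE; split=> [[_ /(_ _ erefl)[g /(_ (lt_succ a)) gg /= ->] _]|[g gg ->]].
  by exists g.
split.
- by move=> E; case/eqP: (succ_neq0 a).
- move=> b E; have ba := succ_inj E; move: E; rewrite ba => E.
  by exists g => //; rewrite (eq_axiomK E).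
- by move/not_limit_succ.
Qed.

Lemma graphL l f : is_limit l -> @graph l f <->
  forall b (h : b < l), exists2 g, @graph b g & compat (ltW h) f g.
Proof.
move=> ll; rewrite graphE; split=> [[_ _ /(_ ll)]//|H]; split => //.
- by move=> E; case: not_limit0; rewrite E.
- by move=> b E; case: (@not_limit_succ b); rewrite E.
Qed.

Lemma graph_total a :
  [/\ exists f, @graph a f,
      forall f f', @graph a f -> @graph a f' -> f = f' &
      forall b (h : b <= a) f g, @graph a f -> @graph b g -> compat h f g].
Proof.
elim/ord_ind: a => a IH.
have ex b : b < a -> exists f, @graph b f by move=> /IH[].
have un b : b < a -> forall f f', @graph b f -> @graph b f' -> f = f'
  by move=> /IH[].
have co b : b < a -> forall c (h : c <= b) f g, @graph b f -> @graph c g -> compat h f g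
  by move=> /IH[].
have una f f' : @graph a f -> @graph a f' -> f = f'.
  have [a0|[b ab]|al] := ord_cases a.
  - by move: f f'; rewrite a0 => f f' /graph0 -> /graph0 ->.
  - move: f f'; rewrite ab => f f' /graphS[g gg ->] /graphS[g' gg' ->].
    by congr s; apply: un => //; rewrite ab lt_succ.
  - move=> /graphL -/(_ al) H /graphL -/(_ al) H'.
    apply: (limit_monic (Y_limit al)) => b hb.
    have [g gg ->] := H b hb; have [g' gg' ->] := H' b hb.
    by rewrite (un b hb g g').
have coa b (h : b <= a) f g : @graph a f -> @graph b g -> compat h f g.
  have [ba|] := eqVneq b a.
    subst b => gf gg; rewrite /compat (una _ _ gf gg).
    by rewrite !res_id mcomp1l mcomp1r.
  move=> nba; have hba : b < a by rewrite lt_neqAle nba.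
  rewrite (bool_irrelevance h (ltW hba)) {h nba} => gf.
  have [a0|[c ac]|al] := ord_cases a; last first.
  - move: gf => /graphL -/(_ al)/(_ b hba)[g' gg'] + gg.
    by rewrite (un b hba g g').
  - subst a; move: gf => /graphS[fc gfc ->{f}].
    elim/ord_ind: b hba g => b IHb hba g gg.
    have [b0|[d bd]|bl] := ord_cases b.
    + subst b; move: gg => /graph0 ->{g}; rewrite /compat.
      rewrite -(res_comp Y (succ_mono (ord_zero_le c)) (le_succ ord_zero)).
      rewrite -(res_comp Z (succ_mono (ord_zero_le c)) (le_succ ord_zero)).
      rewrite -mcompA (s_compat (g := e0)); last first.
        by apply: co => //; [exact: lt_succ|exact/graph0].
      by rewrite mcompA s0 mcompA.
    + subst b; move: gg => /graphS[gd ggd ->{g}].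
      have dc : d <= c by rewrite -succ_lt -ord_succ_le ltW.
      rewrite (bool_irrelevance (ltW hba) (succ_mono dc)).
      by apply: s_compat; apply: co => //; exact: lt_succ.
    + apply: (limit_monic (Y_limit bl)) => d hd.
      move: gg => /graphL -/(_ bl)/(_ d hd)[k gk gkE].
      have da := lt_trans hd hba.
      rewrite mcompA (res_comp _ _ _ (ltW da)) (IHb d hd da k gk).
      by rewrite mcompA gkE -mcompA (res_comp _ _ _ (ltW da)).
  - by subst a; have := hba; rewrite {1}ltNge ord_zero_le.
split => //.
have [a0|[b ab]|al] := ord_cases a.
- by rewrite a0; exists e0; apply/graph0.
- subst a; have [g gg] := ex b (lt_succ b).
  by exists (s g); apply/graphS; exists g.
- pose g b (hb : b < a) := sval (cid (ex b hb)).
  have gP b hb : graph (g b hb) := svalP (cid (ex b hb)).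
  have [|u [uP _]] := Y_limit al (f := fun b hb => g b hb ∘ res Z (ltW hb)).
    move=> b c hb hc h; rewrite mcompA (co _ hb _ h _ _ (gP _ hb) (gP _ hc)).
    by rewrite -mcompA (res_comp _ _ _ (ltW hc)).
  by exists u; apply/graphL => // b hb; exists (g b hb) => //; exact: uP.
Qed.

Lemma recursive_graph e : recursive e -> forall a, graph (e a).
Proof.
move=> [E0 ES EL]; elim/ord_ind => a IH.
have [a0|[b ab]|al] := ord_cases a.
- by subst a; apply/graph0.
- by subst a; apply/graphS; exists (e b) => //; apply: IH; exact: lt_succ.
- by apply/graphL => // b hb; exists (e b); [exact: IH|exact: EL].
Qed.

Lemma recursive_compat e : recursive e ->
  forall a b (h : b <= a), compat h (e a) (e b).
Proof.
move=> /recursive_graph eP a b h; case: (graph_total a) => _ _.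
by apply; exact: eP.
Qed.

Lemma transfinite_recursion : exists! e, recursive e.
Proof.
have ex a : exists f, @graph a f by case: (graph_total a).
have un a : forall f f', @graph a f -> @graph a f' -> f = f'.
  by case: (graph_total a).
pose e a := sval (cid (ex a)).
have eP a : graph (e a) := svalP (cid (ex a)).
exists e; split=> [|e' /recursive_graph e'P].
  split.
  - exact/graph0.
  - by move=> a; have /graphS[g gg ->] := eP (ord_succ a); rewrite (un _ g (e a)).
  - by move=> l ll b h; case: (graph_total l) => _ _; apply.
by apply: functional_extensionality_dep => a; exact: un.
Qed.

End Recursion.

Section TerminalSequence.
Context (H : functor C C) (B : C) (b0 : hom (H B) B).
Context (X : terminal_sequence b0 O).

Definition converges a := is_iso (res X (le_succ a)).

Lemma is_iso_res a (a_conv : converges a) b (h : a <= b) : is_iso (res X h).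
Proof.
elim/ord_ind: b h => b IH h.
have [ba|nba] := eqVneq b a.
  by subst b; exists (idm (X a)); rewrite res_id; split; rewrite mcomp1l.
have ab : a < b by rewrite lt_neqAle eq_sym nba.
have [b_0|[c bc]|bl] := ord_cases b.
- by subst b; have := ab; rewrite {1}ltNge ord_zero_le.
- subst b; have ac : a <= c by rewrite -succ_lt.
  have [g [gl gr]] := IH c (lt_succ c) ac; have [k [kl kr]] := a_conv.
  have rE : res X (succ_mono ac) =
      iso_inv (ts_succ X a) ∘ (fmap H (res X ac) ∘ iso_hom (ts_succ X c)).
    by apply/iso_move; rewrite ts_res_succ.
  rewrite -(res_comp X (succ_mono ac) (le_succ a)) rE.
  exists (iso_inv (ts_succ X c) ∘ fmap H g ∘ iso_hom (ts_succ X a) ∘ k); split.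
  + rewrite !mcompA -[_ ∘ k ∘ _]mcompA kl mcomp1r.
    rewrite -[_ ∘ iso_hom _ ∘ iso_inv _]mcompA iso_homK mcomp1r.
    by rewrite -[_ ∘ fmap H g ∘ _]mcompA -fmapM gl fmap1 mcomp1r iso_invK.
  + rewrite !mcompA -[_ ∘ iso_hom _ ∘ iso_inv _]mcompA iso_homK mcomp1r.
    rewrite -[_ ∘ fmap H _ ∘ fmap H _]mcompA -fmapM gr fmap1 mcomp1r.
    by rewrite -[_ ∘ iso_inv _ ∘ _]mcompA iso_invK mcomp1r.
pose ok c (v : hom (X a) (X c)) :=
  (forall k : a <= c, inverse_of (res X k) v) /\ (forall k : c <= a, v = res X k).
have exv c : c < b -> exists v, ok c v.
  move=> cb; have [ac|ca] := leP a c; last first.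
    exists (res X (ltW ca)); split=> [k|k]; last exact: res_irr.
    by have := lt_le_trans ca k; rewrite ltxx.
  have [v vP] := IH c cb ac; exists v; split=> k; first by rewrite (res_irr _ k ac).
  have E : c = a by apply: le_anti; rewrite k ac.
  subst c; case: vP; rewrite !res_id mcomp1r => ->; by [].
pose v c (cb : c < b) := sval (cid (exv c cb)).
have vP c cb : ok c (v c cb) := svalP (cid (exv c cb)).
have [|u [uP _]] := ts_limit bl (f := v).
  move=> d c db cb cd; have [da|ad] := leP d a.
    have ca := le_trans cd da.
    by rewrite (vP d db).2 (vP c cb).2 (res_comp _ _ _ ca).
  have [v1 v2] := (vP d db).1 (ltW ad).
  have [ca|ac] := leP c a.
    rewrite (vP c cb).2 -(res_comp X (ltW ad) ca cd).
    by rewrite -mcompA v2 mcomp1r.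
  have [w1 w2] := (vP c cb).1 (ltW ac).
  rewrite -[LHS]mcomp1l -w1 -mcompA (mcompA (res X (ltW ac))).
  by rewrite (res_comp _ _ _ (ltW ad)) v2 mcomp1r.
exists u; split.
- apply: (limit_monic (ts_limit bl)) => c cb.
  rewrite mcompA uP mcomp1r; have [ca|ac] := leP c a.
    by rewrite (vP c cb).2 (res_comp _ _ _ (ltW cb)).
  have [w1 w2] := (vP c cb).1 (ltW ac).
  by rewrite -(res_comp X (ltW cb) (ltW ac)) mcompA w1 mcomp1l.
- rewrite (res_irr _ h (ltW ab)) uP.
  by rewrite (vP a ab).2 res_id.
Qed.

Section Final.
Context (g : O) (g_conv : converges g).

Definition final_structure : hom (X g) (H (X g)) :=
  iso_hom (ts_succ X g) ∘ inverse g_conv.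

Context (Z : C) (z : hom Z (H Z)).

Definition coalgebra_morphism (f : hom Z (X g)) :=
  final_structure ∘ f = fmap H f ∘ z.

Program Definition constant_chain : chain C O :=
  @Chain C O (fun _ => Z) (fun _ _ _ => idm Z) _ _.
Next Obligation. by []. Qed.
Next Obligation. by move=> *; rewrite mcomp1l. Qed.

Lemma coalgebra_morphism_unique (f0 : hom Z B) :
  (forall f : hom Z B, b0 ∘ fmap H f ∘ z = f0) ->
  exists! f, coalgebra_morphism f.
Proof.
move=> z0.
pose e0 : hom (constant_chain ord_zero) (X ord_zero) := iso_inv (ts_zero X) ∘ f0.
pose s a (f : hom (constant_chain a) (X a)) :
    hom (constant_chain (ord_succ a)) (X (ord_succ a)) :=
  iso_inv (ts_succ X a) ∘ (fmap H f ∘ z).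
have s0 : compat (le_succ ord_zero) (s ord_zero e0) e0.
  rewrite /compat /= mcomp1r; apply/iso_move.
  rewrite mcompA ts_res_zero -[RHS](z0 (iso_hom (ts_zero X) ∘ e0)).
  rewrite fmapM /s !mcompA; congr (_ ∘ _ ∘ _).
  by rewrite -[_ ∘ iso_hom _ ∘ iso_inv _]mcompA iso_homK mcomp1r.
have s_compat a b (h : b <= a) f k :
    compat h f k -> compat (succ_mono h) (s a f) (s b k).
  rewrite /compat /= !mcomp1r => fk.
  apply/iso_move; rewrite mcompA ts_res_succ /s -fk fmapM !mcompA.
  by rewrite -[_ ∘ iso_hom _ ∘ iso_inv _]mcompA iso_homK mcomp1r.
have Xl := @ts_limit _ _ _ _ _ X.
have [e [recE _]] := transfinite_recursion Xl s0 s_compat.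
have nat_e a b (h : b <= a) : res X h ∘ (e a : hom Z (X a)) = e b.
  by have := recursive_compat Xl s0 s_compat recE h; rewrite /compat /= mcomp1r.
have [E0 ES _] := recE; have [r1 r2] := inverseP g_conv.
exists (e g); split=> [|f fP].
  rewrite /coalgebra_morphism /final_structure -mcompA.
  rewrite -[in LHS](nat_e _ _ (le_succ g)) [inverse _ ∘ _]mcompA r1 mcomp1l ES.
  by rewrite /s mcompA iso_homK mcomp1l.
have fE b (h : b <= g) (h' : ord_succ b <= ord_succ g) :
    iso_hom (ts_succ X b) ∘ res X h' ∘ (inverse g_conv ∘ f) =
    fmap H (res X h ∘ f) ∘ z.
  rewrite (res_irr _ h' (succ_mono h)) ts_res_succ fmapM -[RHS]mcompA -fP.
  by rewrite /final_structure !mcompA.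
suff res_f : forall c (h : c <= g), e c = res X h ∘ f.
  by rewrite (res_f _ (lexx g)) res_id mcomp1l.
have fE' c (h : c <= g) (h' : c <= ord_succ g) :
    res X h ∘ f = res X h' ∘ (inverse g_conv ∘ f).
  rewrite -(res_comp X (le_succ g) h) -mcompA; congr (_ ∘ _).
  by rewrite mcompA r2 mcomp1l.
elim/ord_ind => b IH h.
have [bz|[c bc]|bl] := ord_cases b.
- subst b; rewrite E0; apply/esym/iso_move.
  rewrite (fE' _ h (ord_zero_le _)).
  rewrite -(res_comp X (succ_mono h) (le_succ ord_zero)).
  have := fE _ h (succ_mono h); set k := inverse _ ∘ f => fEk.
  rewrite -[_ ∘ _ ∘ k]mcompA [LHS]mcompA ts_res_zero -[LHS]mcompA.
  rewrite [_ ∘ (_ ∘ k)]mcompA fEk.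
  by rewrite -[RHS](z0 (iso_hom (ts_zero X) ∘ (res X h ∘ f))) !fmapM !mcompA.
- subst b; have hc := le_trans (le_succ c) h.
  rewrite ES; apply/esym/iso_move.
  by rewrite (fE' _ h (succ_mono hc)) [LHS]mcompA (fE _ hc) -IH// lt_succ.
- apply: (limit_monic (Xl _ bl)) => c cb.
  rewrite nat_e mcompA (res_comp _ _ _ (le_trans (ltW cb) h)).
  by rewrite -(IH c cb (le_trans (ltW cb) h)).
Qed.

End Final.
End TerminalSequence.
End SequenceTheory.

Local Close Scope order_scope.

Record language := Language {
  fsym : countType;
  farity : fsym -> nat;
  psym : Type;
  parity : psym -> nat }.

Arguments farity {_} _.
Arguments parity {_} _.

Lemma existT_inj (T : Type) (P : T -> Type) x (a b : P x) :
  existT P x a = existT P x b -> a = b.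
Proof. by move=> E; have := projT2_eq E; rewrite (Prop_irrelevance (projT1_eq E) erefl). Qed.

Section Syntax.
Context (Sg : language).

Inductive term (V : Type) : Type :=
| Var of V
| App (f : fsym Sg) of ('I_(farity f) -> term V).

Record atom (V : Type) := Atom {
  apred : psym Sg;
  aargs : 'I_(parity apred) -> term V }.

Fixpoint tsubst V W (s : V -> term W) (t : term V) : term W :=
  match t with
  | Var x => s x
  | App f a => @App W f (fun i => tsubst s (a i))
  end.

Definition asubst V W (s : V -> term W) (A : atom V) : atom W :=
  @Atom W (apred A) (fun i => tsubst s (@aargs V A i)).

Lemma tsubst_id V (t : term V) : tsubst (@Var V) t = t.
Proof. by elim: t => //= f a IH; congr App; apply: funext. Qed.

Lemma tsubst_comp V W Z (s : W -> term Z) (r : V -> term W) t :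
  tsubst s (tsubst r t) = tsubst (fun x => tsubst s (r x)) t.
Proof. by elim: t => //= f a IH; congr App; apply: funext. Qed.

Lemma asubst_id V (A : atom V) : asubst (@Var V) A = A.
Proof.
by case: A => p a; congr Atom; apply: funext => i /=; rewrite tsubst_id.
Qed.

Lemma asubst_comp V W Z (s : W -> term Z) (r : V -> term W) A :
  asubst s (asubst r A) = asubst (fun x => tsubst s (r x)) A.
Proof.
by case: A => p a; congr Atom; apply: funext => i /=; rewrite tsubst_comp.
Qed.

(* The opposite Lawvere theory of the signature; ['I_n] stands for the        *)
(* variables x_1, ..., x_n.                                                   *)
Definition Lhom (n m : nat) : Type := 'I_n -> term 'I_m.

Program Definition Lop : category :=
  @Category nat Lhom (fun n => @Var 'I_n)
    (fun n m k s r i => tsubst s (r i)) _ _ _.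
Next Obligation. by move=> n m r; apply: funext => i; rewrite tsubst_id. Qed.
Next Obligation. by []. Qed.
Next Obligation.
by move=> n m k l t s r; apply: funext => i; rewrite tsubst_comp.
Qed.

Program Definition At : PSh Lop :=
  @Functor Lop TYPE (fun n => atom 'I_n) (fun n m s A => asubst s A) _ _.
Next Obligation. by move=> n; apply: funext => A; exact: asubst_id. Qed.
Next Obligation.
by move=> n m k s r; apply: funext => A /=; rewrite asubst_comp.
Qed.

(* Clauses are written over the infinite supply of variables x_1, x_2, ...    *)
Record clause := Clause {
  chead : atom nat;
  clen : nat;
  cbody : 'I_clen -> atom nat }.

Record program := Program {
  clauses : set clause;
  clauses_finite : finite_set clauses }.

Definition atom_incl n (A : atom 'I_n) : atom nat :=
  asubst (fun i : 'I_n => @Var nat i) A.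

(* [instance P A Bs] : the set [Bs] is {B_1 t, ..., B_k t}, contained in      *)
(* At(n), for some clause H <- B_1, ..., B_k and some t with A = H t.         *)
Definition instance (P : program) n (A : atom 'I_n) (Bs : set (atom 'I_n)) :=
  exists2 c : clause, clauses P c & exists t : nat -> term nat,
    atom_incl A = asubst t (chead c) /\
    exists B : 'I_(clen c) -> atom 'I_n,
      (forall i, atom_incl (B i) = asubst t (cbody i)) /\ Bs = range B.

Definition term_code V := GenTree.tree (V + fsym Sg).

Fixpoint term_encode V (t : term V) : term_code V :=
  match t with
  | Var x => GenTree.Leaf (inl x)
  | App f a => GenTree.Node 0 (GenTree.Leaf (inr f) ::
      [seq term_encode (a i) | i <- enum 'I_(farity f)])
  end.

Lemma term_encode_inj V : injective (@term_encode V).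
Proof.
move=> t; elim: t => [x [y|f a] //= [->]//|f a IH [y|g b] //= [E]].
subst g => /eq_in_map ab; congr App; apply: funext => i.
by apply: IH; apply: ab; rewrite mem_enum.
Qed.

Lemma countable_seq_term : countable [set: seq (seq (term nat))].
Proof.
apply/countable_injP.
exists (fun l => pickle (map (map (@term_encode nat)) l)) => l k _ _.
move=> /(pcan_inj pickleK).
by apply: inj_map; apply: inj_map; exact: term_encode_inj.
Qed.

Lemma tincl_inj n : injective (tsubst (fun i : 'I_n => @Var nat i)).
Proof.
move=> t; elim: t => [x [y|f a] //= [/val_inj ->]//|f a IH [y|g b] //= E].
have fg : f = g by case: E.
subst g; congr App; apply: funext => i; apply: IH.
by case: E => E1; exact: (congr1 (fun h => h i) (existT_inj E1)).
Qed.

Lemma atom_incl_inj n : injective (@atom_incl n).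
Proof.
case=> p a [q b] E; have pq : p = q by case: E.
subst q; congr Atom; apply: funext => i; apply: tincl_inj.
by case: E => E1; exact: (congr1 (fun h => h i) (existT_inj E1)).
Qed.

Lemma instance_finite P n A (Bs : set (atom 'I_n)) : instance P A Bs -> finite_set Bs.
Proof.
move=> [c _ [t [_ [B [_ ->]]]]].
by apply: finite_image; exact: finite_finset.
Qed.

Lemma instance_countable P n (A : atom 'I_n) : countable [set Bs | instance P A Bs].
Proof.
pose dec (c : clause) (l : seq (seq (term nat))) : set (atom 'I_n) :=
  [set B | exists i : 'I_(clen c), atom_incl B =
    @Atom nat (apred (cbody i)) (fun j => nth (@Var nat 0) (nth [::] l i) j)].
have cD : countable (\bigcup_(c in clauses P) range (dec c)).
  apply: bigcup_countable; first exact: finite_set_countable (clauses_finite P).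
  move=> c _; apply: sub_countable countable_seq_term; exact: card_image_le.
apply: sub_countable cD; apply: subset_card_le => Bs.
move=> [c Pc [t [_ [B [BE ->]]]]]; exists c => //.
exists [seq [seq tsubst t (@aargs nat (cbody i) j) | j <- enum 'I_(parity (apred (cbody i)))]
  | i <- enum 'I_(clen c)] => //.
have decE (i : 'I_(clen c)) : asubst t (cbody i) = @Atom nat (apred (cbody i))
    (fun j => nth (@Var nat 0) (nth [::] [seq [seq tsubst t (@aargs nat (cbody i) j)
      | j <- enum 'I_(parity (apred (cbody i)))] | i <- enum 'I_(clen c)] i) j).
  congr Atom; apply: funext => j.
  rewrite (nth_map i) ?size_enum_ord// nth_ord_enum.
  by rewrite (nth_map j) ?size_enum_ord// nth_ord_enum.
rewrite /dec; apply/seteqP; split=> [b [i bE]|_ [i _ <-]] /=.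
  by exists i => //; apply: atom_incl_inj; rewrite BE bE decE.
by exists i; rewrite BE decE.
Qed.
End Syntax.

Definition Pc_set (T : Type) := {A : set T | countable A}.
Definition Pf_set (T : Type) := {A : set T | finite_set A}.

Lemma countable_image (T T' : Type) (f : T -> T') (A : set T) :
  countable A -> countable (f @` A).
Proof. by apply: sub_countable; exact: card_image_le. Qed.

Lemma sig_eq (T : Type) (P : T -> Prop) (x y : {a | P a}) : sval x = sval y -> x = y.
Proof. by case: x y => x px [y py] /= xy; subst y; congr exist; exact: Prop_irrelevance. Qed.

Program Definition Pc : functor TYPE TYPE :=
  @Functor TYPE TYPE Pc_set
    (fun T T' f A => exist _ (f @` sval A) (countable_image f (svalP A))) _ _.
Next Obligation. by move=> T; apply: funext => A; apply: sig_eq; exact: image_id. Qed.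
Next Obligation.
by move=> T T' T'' g f; apply: funext => A; apply: sig_eq; rewrite /= image_comp.
Qed.

Program Definition Pf : functor TYPE TYPE :=
  @Functor TYPE TYPE Pf_set
    (fun T T' f A => exist _ (f @` sval A) (finite_image f (svalP A))) _ _.
Next Obligation. by move=> T; apply: funext => A; apply: sig_eq; exact: image_id. Qed.
Next Obligation.
by move=> T T' T'' g f; apply: funext => A; apply: sig_eq; rewrite /= image_comp.
Qed.

Program Definition fam_lift (I : Type) (F : functor TYPE TYPE) :
    functor (Fam I) (Fam I) :=
  @Functor (Fam I) (Fam I) (fun G i => F (G i))
    (fun G G' t i => @fmap TYPE TYPE F (G i) (G' i) (t i)) _ _.
Next Obligation.
by move=> I F G; apply: functional_extensionality_dep => i; rewrite fmap1.
Qed.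
Next Obligation.
move=> I F G G' G'' t s; apply: functional_extensionality_dep => i.
exact: (@fmapM TYPE TYPE F _ _ _ (t i) (s i)).
Qed.

Section Saturation.
Context (Sg : language).
Local Notation L := (Lop Sg).

Program Definition U : functor (PSh L) (Fam nat) :=
  @Functor (PSh L) (Fam nat) (fun G n => G n) (fun G G' t n => nt t n) _ _.
Next Obligation. by []. Qed.
Next Obligation. by []. Qed.

Program Definition K_psh (F : Fam nat) : PSh L :=
  @Functor L TYPE (fun n => forall m : nat, Lhom Sg n m -> F m)
    (fun n m s x k r => x k ((r : @hom L m k) ∘ s)) _ _.
Next Obligation.
move=> F n; apply: funext => x /=; apply: functional_extensionality_dep => m.
by apply: funext => s; congr (x m _); exact: (@mcomp1r L).
Qed.
Next Obligation.
move=> F n m k s r; apply: funext => x; apply: functional_extensionality_dep => l.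
by apply: funext => q; congr (x l _); exact: (@mcompA L).
Qed.

Program Definition K : functor (Fam nat) (PSh L) :=
  @Functor (Fam nat) (PSh L) K_psh
    (fun F G t => @NatTrans L TYPE (K_psh F) (K_psh G)
      (fun n x m s => t m (x m s)) _) _ _.
Next Obligation. by []. Qed.
Next Obligation. by move=> F; apply: nat_trans_eq. Qed.
Next Obligation. by move=> *; apply: nat_trans_eq. Qed.

Program Definition eta (G : PSh L) : hom G (K (U G)) :=
  @NatTrans L TYPE G (K (U G)) (fun n x m s => fmap G s x) _.
Next Obligation.
move=> G n m s; apply: funext => x; apply: functional_extensionality_dep => k.
by apply: funext => r /=; rewrite fmapM.
Qed.

Definition epsilon (F : Fam nat) : hom (U (K F)) F := fun n x => x n (@idm L n).
Arguments epsilon : clear implicits.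

Definition Q : functor (Fam nat) (Fam nat) :=
  functor_comp (fam_lift nat Pc) (fam_lift nat Pf).

Definition KQU : functor (PSh L) (PSh L) := functor_comp K (functor_comp Q U).

Context (O : ordinals) (A : PSh L).

Definition prodS : functor (PSh L) (PSh L) := functor_comp (psh_prod A) KQU.

Definition prodQ : functor (Fam nat) (Fam nat) := functor_comp (fam_prod (U A)) Q.

(* Terminal sequences of  A x KQU(-)  and  UA x Q(-), whose zeroth objects are  *)
(* A and UA.                                                                  *)
Definition S_sequence := terminal_sequence (H := prodS) (psh_fst A (KQU A)) O.

Definition Q_sequence := terminal_sequence (H := prodQ) (fam_fst (U A) (Q (U A))) O.

Context (X : S_sequence) (Y : Q_sequence).

Program Definition U_chain : chain (Fam nat) O :=
  @Chain (Fam nat) O (fun a => U (X a)) (fun a b h => fmap U (res X h)) _ _.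
Next Obligation. move=> a h; exact: etrans (congr1 (fmap U) (res_id X h)) (fmap1 U _). Qed.
Next Obligation. move=> a b c h1 h2 h3.
exact: etrans (esym (fmapM U _ _)) (congr1 (fmap U) (res_comp X h1 h2 h3)). Qed.

(* The domain of this map is [U (prodS _)], as [U] preserves products on the  *)
(* nose.                                                                      *)
Definition desat_step (F : PSh L) (G : Fam nat) (d : hom (U F) G) :
    hom (U (prodS F)) (prodQ G) :=
  fmap (fam_prod (U A)) (fmap Q d ∘ epsilon (Q (U F))).

Definition is_desaturation (d : forall a, hom (U (X a)) (Y a)) :=
  [/\ iso_hom (ts_zero Y) ∘ d ord_zero = fmap U (iso_hom (ts_zero X)),
      forall a, iso_hom (ts_succ Y a) ∘ d (ord_succ a) =
        desat_step (d a) ∘ fmap U (iso_hom (ts_succ X a)) &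
      forall l, is_limit l -> forall b (h : (b < l)%O),
        res Y (ltW h) ∘ d l = d b ∘ fmap U (res X (ltW h))].

Lemma desaturation_unique : exists! d, is_desaturation d.
Proof.
pose e0 : hom (U_chain ord_zero) (Y ord_zero) :=
  iso_inv (ts_zero Y) ∘ fmap U (iso_hom (ts_zero X)).
pose s a (d : hom (U_chain a) (Y a)) : hom (U_chain (ord_succ a)) (Y (ord_succ a)) :=
  iso_inv (ts_succ Y a) ∘ (desat_step d ∘ fmap U (iso_hom (ts_succ X a))).
have recE d : recursive e0 s d <-> is_desaturation d.
  split=> -[d0 dS dL]; split => //.
  - by apply/iso_move; exact: d0.
  - by move=> a; apply/iso_move; exact: dS.
  - by apply/iso_move; exact: d0.
  - by move=> a; apply/iso_move; exact: dS.
have [|||d [/recE dP du]] := @transfinite_recursion _ _ U_chain Y e0 s.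
- exact: ts_limit.
- rewrite /compat; apply/iso_move; rewrite [LHS]mcompA ts_res_zero.
  rewrite -[LHS]mcompA [X in _ ∘ X]mcompA iso_homK mcomp1l.
  apply: functional_extensionality_dep => i; apply: funext => y.
  by have /(congr1 (fun t => fmap U t i y)) /= -> := ts_res_zero X.
- move=> a b h f f' ff'; rewrite /compat; apply/iso_move.
  rewrite [LHS]mcompA ts_res_succ -[LHS]mcompA [X in _ ∘ X]mcompA iso_homK mcomp1l.
  apply: functional_extensionality_dep => i; apply: funext => y.
  have /(congr1 (fun t => fmap U t i y)) /= E := ts_res_succ X h.
  rewrite /= E /=; congr pair.
  have F := etrans (etrans (esym (fmapM Q (res Y h) f)) (congr1 (fmap Q) ff'))
    (fmapM Q f' (res U_chain h)).
  exact: (congr1 (fun t => t i (epsilon (Q (U (X a))) i (nt (iso_hom (ts_succ X a)) i y).2)) F).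
by exists d; split => // d' /recE /du.
Qed.

Definition desaturation : forall a, hom (U (X a)) (Y a) :=
  sval (cid desaturation_unique).

Context (g : O) (g_conv : converges X g) (x : O).

(* With [Y] convergent at [x], this goes from the carrier of the final         *)
(* (A x KQU(-))-coalgebra to that of the final (UA x Q(-))-coalgebra.          *)
Definition desaturation_bar : hom (U (X g)) (Y x) :=
  match leP x g with
  | Order.LelNotGt h => @desaturation x ∘ fmap U (res X h)
  | Order.GtlNotLe h => @desaturation x ∘ fmap U (inverse (is_iso_res g_conv (ltW h)))
  end.

End Saturation.

Arguments desaturation_bar {Sg O A X} Y {g} g_conv x.

Section Semantics.
Context (Sg : language) (P : program Sg).
Local Notation At := (At Sg).

Lemma step_countable n (A : atom Sg 'I_n) :
  countable [set Bs : Pf_set (atom Sg 'I_n) | instance P A (sval Bs)].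
Proof.
have /countable_injP[f f_inj] := instance_countable P A.
apply/countable_injP; exists (fun Bs => f (sval Bs)) => Bs Bs'.
by rewrite !inE => iBs iBs' /f_inj E; apply/sig_eq/E; rewrite inE.
Qed.

Definition step : hom (U _ At) (Q (U _ At)) := fun n A =>
  exist (fun C : set (Pf_set (atom Sg 'I_n)) => countable C) _ (step_countable A).

Definition saturated_step : hom At (KQU _ At) := fmap (K _) step ∘ eta At.

Context (O : ordinals) (X : S_sequence O At) (g : O) (g_conv : converges X g).

Lemma saturated_semantics_unique : exists! f : hom At (X g),
  coalgebra_morphism g_conv (psh_pair (idm At) saturated_step) f.
Proof.
apply: (@coalgebra_morphism_unique _ _ _ _ _ X g g_conv _ _ (idm At)) => f.
by apply: nat_trans_eq => n; apply: funext.
Qed.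

(* The unique morphism from (At, <id, p#>) to the final (At x KQU(-))-coalgebra *)
(* carried by [X g].                                                          *)
Definition saturated_semantics : hom At (X g) :=
  sval (cid saturated_semantics_unique).

End Semantics.

(* Possibly infinite trees alternating and-nodes, labelled in [T], and        *)
(* or-nodes, whose root is an and-node.  Or-nodes carry no label, since they  *)
(* would all have the same one.                                               *)
Record tree (T : Type) := Tree {
  and_node : Type;
  or_node : Type;
  tree_root : and_node;
  label : and_node -> T;
  or_children : and_node -> set or_node;
  and_children : or_node -> set and_node;
  or_parent : forall t, exists! s, or_children s t;
  and_parent : forall s, s <> tree_root -> exists! t, and_children t s;
  root_orphan : forall t, ~ and_children t tree_root;
  reachable : forall s, clos_refl_trans and_node
    (fun u v => exists2 t, or_children u t & and_children t v) tree_root s }.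

Arguments or_children {_ _} _ _.
Arguments and_children {_ _} _ _.

(* The tree of [y : V] for [c : V -> T * Pc (Pf V)]: the root is labelled     *)
(* (c y).1 and has one child for each [W] in (c y).2, whose children are the  *)
(* roots of the trees of the elements of [W].  An and-node is represented by  *)
(* the path from the root that leads to it, latest step first, and an or-node *)
(* by its parent and an element of the set of that parent.                    *)
Section Unfolding.
Context (T V : Type) (c : V -> T * Pc_set (Pf_set V)) (y : V).

Definition state (p : seq (Pf_set V * V)) : V := if p is (_, v) :: _ then v else y.

Fixpoint unfold_path (p : seq (Pf_set V * V)) : Prop :=
  if p is (W, v) :: q then [/\ sval (c (state q)).2 W, sval W v & unfold_path q] else True.

Definition unfold_and := {p | unfold_path p}.

Definition unfold_or := {s : unfold_and * Pf_set V | sval (c (state (sval s.1))).2 s.2}.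

Definition unfold_root : unfold_and := exist unfold_path [::] I.

Definition unfold_or_children (s : unfold_and) : set unfold_or :=
  [set t | (sval t).1 = s].

Definition unfold_and_children (t : unfold_or) : set unfold_and :=
  [set s | exists v, sval s = ((sval t).2, v) :: sval (sval t).1].

Program Definition unfolding : tree T :=
  @Tree T unfold_and unfold_or unfold_root (fun s => (c (state (sval s))).1)
    unfold_or_children unfold_and_children _ _ _ _.
Next Obligation. by move=> t; exists (sval t).1. Qed.
Next Obligation.
move=> [[|[W v] q] pq]; first by case; congr exist; exact: Prop_irrelevance.
move=> _; case: (pq) => cW Wv pq'.
exists (exist _ (exist unfold_path q pq', W) cW); split; first by exists v.
move=> [[[q' q'P] W'] cW'] [v' /= [E1 E2 E3]]; apply: sig_eq => /=.
by subst W' q'; congr pair; apply: sig_eq.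
Qed.
Next Obligation. by move=> t [v]. Qed.
Next Obligation.
move=> [q qP]; elim: q qP => [|[W v] q IH] qP.
  by rewrite (Prop_irrelevance qP I); exact: rt_refl.
case: (qP) => cW Wv qP'; apply: rt_trans (IH qP') _; apply: rt_step.
by exists (exist _ (exist unfold_path q qP', W) cW) => //; exists v.
Qed.

End Unfolding.

(* [t] has exactly one child labelled [B] for each [B] in [Bs], and no other  *)
(* children.                                                                  *)
Definition children_labelled T (R : tree T) (t : or_node R) (Bs : set T) :=
  (forall B, Bs B -> exists! s, and_children t s /\ label s = B) /\
  (forall s, and_children t s -> Bs (label s)).

(* [R] is the n-coinductive tree of [A].  Pairs of a clause and a             *)
(* substitution yielding the same set of atoms share their child.             *)
Definition is_coinductive_tree (Sg : language) (P : program Sg) n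
    (A : atom Sg 'I_n) (R : tree (atom Sg 'I_n)) :=
  label (tree_root R) = A /\
  forall s : and_node R,
    (forall Bs, instance P (label s) Bs ->
      exists! t, or_children s t /\ children_labelled t Bs) /\
    (forall t, or_children s t ->
      exists2 Bs, instance P (label s) Bs & children_labelled t Bs).

(* The tree represented by an element of the carrier [Y x] of the final       *)
(* (UAt x Q(-))-coalgebra.                                                    *)
Definition tree_of (Sg : language) (O : ordinals) (Y : Q_sequence O (At Sg))
    (x : O) (x_conv : converges Y x) (n : nat) (y : Y x n) : tree (atom Sg 'I_n) :=
  unfolding (final_structure x_conv n) y.

(* Main.v *)
Require Import Defs.
From mathcomp Require Import all_boot all_order.
From mathcomp Require Import boolp classical_sets functions cardinality.

(* The saturated semantics f : At -> X_gamma extends to a cone e_a : At ->    *)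
(* X_a over the whole terminal sequence with e_{a+1} = <id, S(e_a) o p#>,     *)
(* and desaturating it gives D_a = d_a o U(e_a), a cone over Y: the counit in *)
(* the definition of d_{a+1} selects the component of p# at the identity      *)
(* substitution, so that D_{a+1} = <id, Q(D_a) o p>.  Hence D_chi, which is   *)
(* the map of the theorem, is a coalgebra morphism from <id, p> to the final  *)
(* coalgebra, and its first component makes it injective: unfolding D_chi(A)  *)
(* is unfolding A along p, and this is the coinductive tree.                  *)

Set Implicit Arguments.
Unset Strict Implicit.
Unset Printing Implicit Defensive.

Import Order.TTheory.

Local Open Scope classical_set_scope.
Local Open Scope cat_scope.

(** Only the cone legs at chi and its successor matter. [at_stage_succ] says that the would-be leg
    at the successor restricts to the leg at chi; [desaturation_natural] carries this over to [Y],
    whence [desaturation_coalgebra_morphism]. What remains, [unfolding_labelled], concerns any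
    coalgebra morphism [D] out of a coalgebra with first component the identity. *)

Section AtStage.
Context (C : category) (O : ordinals) (H : functor C C) (B : C).
Context (b0 : hom (H B) B) (X : terminal_sequence b0 O).
Context (g : O) (g_conv : converges X g).
Context (Z : C) (z : hom Z (H Z)) (f : hom Z (X g)).
Hypothesis f_morph : coalgebra_morphism g_conv z f.

(** The case split is that of [desaturation_bar], so that the two match branch by branch. *)
Definition at_stage (x : O) : hom Z (X x) :=
  match leP x g with
  | Order.LelNotGt h => res X h ∘ f
  | Order.GtlNotLe h => inverse (is_iso_res g_conv (ltW h)) ∘ f
  end.

Lemma inverse_coalgebra_morphism :
  inverse g_conv ∘ f = iso_inv (ts_succ X g) ∘ (fmap H f ∘ z).
Proof. by apply/iso_move; rewrite -f_morph /final_structure mcompA. Qed.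

(** At x = g this is [inverse_coalgebra_morphism]; below g it is the restriction of that case, and
    above g it can be tested after restricting to g, which is invertible. *)
Lemma at_stage_succ (x : O) :
  res X (le_succ x) ∘ (iso_inv (ts_succ X x) ∘ (fmap H (at_stage x) ∘ z)) =
  at_stage x.
Proof.
have [r1 r2] := inverseP g_conv.
(* Passing from a leg to its successor commutes with restriction. *)
have restrict a b (h : (b <= a)%O) (k : hom Z (X a)) :
    res X (succ_mono h) ∘ (iso_inv (ts_succ X a) ∘ (fmap H k ∘ z)) =
    iso_inv (ts_succ X b) ∘ (fmap H (res X h ∘ k) ∘ z).
  apply/iso_move; rewrite mcompA ts_res_succ -mcompA [X in _ ∘ X]mcompA iso_homK.
  by rewrite mcomp1l fmapM mcompA.
rewrite /at_stage; case: leP => h.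
  rewrite -restrict -inverse_coalgebra_morphism mcompA.
  rewrite (res_comp _ _ _ (le_trans h (le_succ g))).
  by rewrite -(res_comp X (le_succ g) h) -mcompA [X in _ ∘ X]mcompA r2 mcomp1l.
have [v1 v2] := inverseP (is_iso_res g_conv (ltW h)).
set v := inverse _ in v1 v2 *; set k := iso_inv _ ∘ _.
suff E : res X (ltW h) ∘ (res X (le_succ x) ∘ k) = f.
  by rewrite -[LHS]mcomp1l -v1 -mcompA E.
rewrite mcompA (res_comp _ _ _ (le_trans (ltW h) (le_succ x))).
rewrite -(res_comp X (succ_mono (ltW h)) (le_succ g)) -mcompA restrict.
rewrite [X in fmap H X]mcompA v2 mcomp1l -inverse_coalgebra_morphism.
by rewrite mcompA r2 mcomp1l.
Qed.

End AtStage.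

Section Desaturation.
Context (Sg : language) (O : ordinals) (A : PSh (Lop Sg)).
Context (X : S_sequence O A) (Y : Q_sequence O A).
Local Notation d a := (@desaturation _ _ _ X Y a).

Lemma desaturationP : is_desaturation (@desaturation _ _ _ X Y).
Proof. by rewrite /desaturation; case: cid => ? []. Qed.

(** [is_desaturation] asks for this only from limit stages. The recursion data [e0] and [s] are
    rebuilt so that [recursive_compat] extends it to all pairs. *)
Lemma desaturation_natural (a b : O) (h : (b <= a)%O) :
  res Y h ∘ d a = d b ∘ fmap (U Sg) (res X h).
Proof.
have [d0 dS dL] := desaturationP.
pose e0 : hom (U_chain X ord_zero) (Y ord_zero) :=
  iso_inv (ts_zero Y) ∘ fmap (U Sg) (iso_hom (ts_zero X)).
pose s a (k : hom (U_chain X a) (Y a)) :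
    hom (U_chain X (ord_succ a)) (Y (ord_succ a)) :=
  iso_inv (ts_succ Y a) ∘ (desat_step k ∘ fmap (U Sg) (iso_hom (ts_succ X a))).
apply: (@recursive_compat _ _ (U_chain X) Y e0 s).
- exact: ts_limit.
- rewrite /compat; apply/iso_move; rewrite [LHS]mcompA ts_res_zero.
  rewrite -[LHS]mcompA [X in _ ∘ X]mcompA iso_homK mcomp1l.
  apply: functional_extensionality_dep => i; apply: funext => y.
  by have /(congr1 (fun t => fmap (U Sg) t i y)) /= -> := ts_res_zero X.
- move=> {}a {}b {}h k k' kk'; rewrite /compat; apply/iso_move.
  rewrite [LHS]mcompA ts_res_succ -[LHS]mcompA [X in _ ∘ X]mcompA iso_homK mcomp1l.
  apply: functional_extensionality_dep => i; apply: funext => y.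
  have /(congr1 (fun t => fmap (U Sg) t i y)) /= E := ts_res_succ X h.
  rewrite /= E /=; congr pair.
  have F := etrans (etrans (esym (fmapM Q (res Y h) k)) (congr1 (fmap Q) kk'))
    (fmapM Q k' (res (U_chain X) h)).
  exact: (congr1 (fun t => t i (epsilon (nt (iso_hom (ts_succ X a)) i y).2)) F).
- by split=> // [|c]; apply/iso_move; [exact: d0|exact: dS].
Qed.

Lemma desaturation_barE (Z : PSh (Lop Sg)) (g x : O) (g_conv : converges X g)
    (f : hom Z (X g)) :
  desaturation_bar Y g_conv x ∘ fmap (U Sg) f =
  d x ∘ fmap (U Sg) (at_stage g_conv f x).
Proof. by rewrite /desaturation_bar /at_stage; case: leP. Qed.

Lemma desaturation_coalgebra_morphism (p : hom (U Sg A) (Q (U Sg A)))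
    (g x : O) (g_conv : converges X g) (x_conv : converges Y x)
    (f : hom A (X g)) :
  coalgebra_morphism g_conv (psh_pair (idm A) (fmap (K Sg) p ∘ eta A)) f ->
  coalgebra_morphism x_conv (fun n a => (a, p n a))
    (desaturation_bar Y g_conv x ∘ fmap (U Sg) f).
Proof.
move=> f_morph; set z := psh_pair _ _ in f_morph.
have [y1 y2] := inverseP x_conv; have [_ dS _] := desaturationP.
pose e := at_stage g_conv f x.
pose e' := iso_inv (ts_succ X x) ∘ (fmap (prodS A) e ∘ z).
have res_e' : res X (le_succ x) ∘ e' = e by exact: at_stage_succ.
rewrite /coalgebra_morphism desaturation_barE -/e.
(* Factoring through the successor stage lets the inverse inside [final_structure] cancel. *)
have De : res Y (le_succ x) ∘ (d (ord_succ x) ∘ fmap (U Sg) e') =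
    d x ∘ fmap (U Sg) e.
  by rewrite -res_e' mcompA desaturation_natural.
rewrite /final_structure -[in LHS]De -[LHS]mcompA [X in _ ∘ X]mcompA y1 mcomp1l.
rewrite [LHS]mcompA dS -[LHS]mcompA.
have -> : fmap (U Sg) (iso_hom (ts_succ X x)) ∘ fmap (U Sg) e' =
    fmap (U Sg) (fmap (prodS A) e ∘ z).
  by rewrite -fmapM /e' mcompA iso_homK mcomp1l.
apply: functional_extensionality_dep => n; apply: funext => a.
congr pair.
apply: etrans (esym (congr1 (fun t => t n (p n a)) (fmapM Q (d x) (fmap (U Sg) e)))).
(* The counit has picked the component at the identity substitution, where [eta] leaves
   [fmap A (idm n) a] in place of [a]. *)
have /(congr1 (fun h => h a)) := fmap1 A n.
exact: (congr1 (fun b => fmap Q (d x) n (fmap Q (fmap (U Sg) e) n (p n b)))).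
Qed.

End Desaturation.

(** The set is recovered as the labels of the children of [t]. *)
Lemma children_labelled_inj (T : Type) (R : tree T) (t : or_node R) (S S' : set T) :
  children_labelled t S -> children_labelled t S' -> S = S'.
Proof.
move=> [S1 S2] [S'1 S'2]; apply/seteqP; split=> b.
  by move=> /S1[s [[ts <-] _]]; exact: S'2.
by move=> /S'1[s [[ts <-] _]]; exact: S2.
Qed.

Section Unfolding.
Context (T V : Type) (c : V -> T * Pc_set (Pf_set V)) (D : T -> V).
Context (z : T -> Pc_set (Pf_set T)).
Hypothesis cD : forall a, c (D a) = (a, fmap Pc (fmap Pf D) (z a)).
Context (a : T).
Local Notation R := (unfolding c (D a)).

Lemma unfolding_state (s : and_node R) : state (D a) (sval s) = D (label s).
Proof.
(* Once a state lies in the image of [D], [cD] reads its preimage back as the label; the image is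
   closed under successors. *)
suff [b E] : exists b, state (D a) (sval s) = D b by rewrite /= E cD.
case: s => -[|[W v] q] /=; first by exists a.
elim: q W v => [|[W' v'] q IH] W v /= [+ Wv pq].
  by rewrite cD => -[S _ SW]; move: Wv; rewrite -SW => -[b _ <-]; exists b.
have [b ->] := IH W' v' pq.
by rewrite cD => -[S _ SW]; move: Wv; rewrite -SW => -[b' _ <-]; exists b'.
Qed.

Lemma unfolding_children (s : and_node R) (t : or_node R) : or_children s t ->
  exists2 S, sval (z (label s)) S & sval (sval t).2 = D @` sval S.
Proof.
move=> ts; have := svalP t; rewrite /= ts unfolding_state cD => -[S zS <-].
by exists S.
Qed.

Lemma unfolding_children_labelled (t : or_node R) (S : set T) :
  sval (sval t).2 = D @` S -> children_labelled t S.
Proof.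
case: t => -[s W] cW /= WS; split=> [b Sb|].
  have Wb : sval W (D b) by rewrite WS; exists b.
  exists (exist _ ((W, D b) :: sval s) (And3 cW Wb (svalP s))).
  split; first by split; [exists (D b)|rewrite /= cD].
  (* Uniqueness: by [cD] a child [D b'] has label [b'], so its label determines it. *)
  move=> [q qP] [[v /= E] /= lb]; apply: sig_eq => /=.
  move: qP lb; rewrite E /= => -[_ + _]; rewrite WS => -[b' _ <-].
  by rewrite cD => /= ->.
move=> [q qP] [v /= E]; move: qP; rewrite E /= => -[_ + _].
by rewrite WS => -[b' Sb' <-]; rewrite cD.
Qed.

Lemma unfolding_labelled :
  label (tree_root R) = a /\
  forall s : and_node R,
    (forall S, sval (z (label s)) S ->
      exists! t, or_children s t /\ children_labelled t (sval S)) /\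
    (forall t, or_children s t ->
      exists2 S, sval (z (label s)) S & children_labelled t (sval S)).
Proof.
split; first by rewrite /= cD.
move=> s; split=> [S zS|t /unfolding_children[S zS SE]]; last first.
  by exists S => //; exact: unfolding_children_labelled.
have cS : sval (c (state (D a) (sval s))).2 (fmap Pf D S).
  by rewrite unfolding_state cD; exists S.
exists (exist _ (s, fmap Pf D S) cS); split.
  by split=> //; exact: unfolding_children_labelled.
(* An or-node is its parent together with a set of states, here the image of some [S']; the labels
   force [S'] to agree with [S]. *)
move=> t [st tS]; have [S' zS' S'E] := unfolding_children st.
have SS' := children_labelled_inj tS (unfolding_children_labelled S'E).
apply: sig_eq => /=; rewrite (surjective_pairing (sval t)).
by rewrite -st; congr pair; apply: sig_eq; rewrite S'E -SS'.
Qed.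

End Unfolding.

Theorem theorem5p3 (Sg : language) (P : program Sg) (O : ordinals)
  (X : S_sequence O (At Sg)) (Y : Q_sequence O (At Sg)) (gamma chi : O)
  (X_conv : converges X gamma) (Y_conv : converges Y chi)
  (n : nat) (A : U Sg (At Sg) n) :
  is_coinductive_tree P A
    (tree_of Y_conv
      ((desaturation_bar Y X_conv chi ∘
             fmap (U Sg) (saturated_semantics P X_conv))%cat n A)).
Proof.
have semP : coalgebra_morphism X_conv (psh_pair (idm (At Sg)) (saturated_step P))
    (saturated_semantics P X_conv).
  by rewrite /saturated_semantics; case: cid => ? [].
have /(congr1 (@^~ n)) D_morph :=
  @desaturation_coalgebra_morphism _ _ _ _ _ (step P) _ _ _ Y_conv _ semP.
have [root_A nodes] := @unfolding_labelled _ _ (final_structure Y_conv n) _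
  (@step _ P n) (fun a => congr1 (@^~ a) D_morph) A.
split=> // s; have [all_S only_S] := nodes s.
split=> [Bs iBs|t /only_S[S iS tS]]; last by exists (sval S).
(* Elements of [step] are packaged finite sets, whereas [instance] speaks of bare sets. *)
exact: all_S (exist _ Bs (instance_finite iBs)) iBs.
Qed.
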